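(* Let $n\geq2$ be an integer and let $\|x\|=\sqrt{x_1^2+\ldots+x_n^2}$ be the Euclidean norm on $\mathbb{R}^n$. Then for all $f\in C_0^1(\mathbb{R}^n)$, $$\left(\int_{\mathbb{R}^{n}}|f(x)|^{2}dx\right)^{2}\leq\left(\frac{2}{n}\right)^{2}\int_{\mathbb{R}^{n}}\left|\nabla f(x)\right|^{2}dx\int_{\mathbb{R}^{n}}\|x\|^{2}|f(x)|^{2}dx,$$ where $\nabla$ is the standard gradient on $\mathbb{R}^n$.
   Context: $C_0^1(\mathbb{R}^n)$ denotes compactly supported $C^1$ functions on $\mathbb{R}^n$. *)

(* Defs.v *)
From HB Require Import structures.
From mathcomp Require Import all_boot all_order all_algebra.
From mathcomp Require Import all_classical all_reals all_analysis.
From mathcomp Require Import complex.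

Set Implicit Arguments.
Unset Strict Implicit.
Unset Printing Implicit Defensive.

Import Order.TTheory GRing.Theory Num.Theory numFieldNormedType.Exports.

Local Open Scope classical_set_scope.
Local Open Scope ring_scope.

(* R^n is 'rV[R]_n, with the sigma-algebra generated by the coordinate maps,
   i.e. the Borel sigma-algebra; this is how the library equips n.-tuple. *)
Section measurable_rV.
Context {R : realType} {n : nat}.

Let coords : 'I_n -> 'rV[R]_n -> R := fun i x => x ord0 i.

HB.instance Definition _ := @isMeasurable.Build
  (measure_tuple_display default_measure_display)
  'rV[R]_n (g_sigma_preimage coords) (@sigma_algebra0 _ _ _)
  (@sigma_algebraC _ _) (@sigma_algebra_bigcup _ _ _).

Lemma measurable_coord (i : 'I_n) :
  measurable_fun [set: 'rV[R]_n] (fun x => x ord0 i).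
Proof.
move=> _ Y mY; rewrite setTI; apply: sub_sigma_algebra => /=.
rewrite -bigcup_seq/=; exists i => /=; first by rewrite mem_index_enum.
by exists Y => //; rewrite setTI.
Qed.

Lemma measurable_fun_coordP d (T : measurableType d) (f : T -> 'rV[R]_n) :
  (forall i, measurable_fun [set: T] (fun x => f x ord0 i)) ->
  measurable_fun [set: T] f.
Proof.
move=> mf.
apply: (measurability (\big[setU/set0]_(i < n)
  preimage_set_system setT (coords i) measurable)) => //.
move=> _ [B + <-]; rewrite -bigcup_seq => -[i _ [C mC <-]].
rewrite setTI -comp_preimage; exact: mf.
Qed.

End measurable_rV.

Section lebesgue_rV.
Context {R : realType}.
Local Open Scope ereal_scope.

(* the identification of R * R^n with R^(n+1) *)
Definition rV_cons (n : nat) (p : measurableTypeR R * 'rV[R]_n) :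
    'rV[R]_n.+1 :=
  row_mx (p.1)%:M p.2.

Lemma rV_cons0 n (p : measurableTypeR R * 'rV[R]_n) : rV_cons p ord0 ord0 = p.1.
Proof.
rewrite mxE; case: splitP => [j _|j]//; by rewrite (ord1 j) mxE mulr1n.
Qed.

Lemma rV_consS n (p : measurableTypeR R * 'rV[R]_n) (i : 'I_n) :
  rV_cons p ord0 (lift ord0 i) = p.2 ord0 i.
Proof.
rewrite mxE; case: splitP => j; first by rewrite (ord1 j).
by move=> /=; rewrite /bump /= => -[] /val_inj ->.
Qed.

Lemma measurable_rV_cons n :
  measurable_fun [set: measurableTypeR R * 'rV[R]_n] (@rV_cons n).
Proof.
apply: measurable_fun_coordP => i; case: (unliftP ord0 i) => [j|] ->.
  rewrite (_ : (fun _ => _) = (fun v : 'rV[R]_n => v ord0 j) \o snd); last first.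
    by apply/funext => p; rewrite rV_consS.
  by apply: measurableT_comp => //; exact: measurable_coord.
rewrite (_ : (fun _ => _) = fst); last by apply/funext => p; rewrite rV_cons0.
exact: measurable_fst.
Qed.

HB.instance Definition _ n :=
  isMeasurableFun.Build _ _ _ _ (@rV_cons n) (@measurable_rV_cons n).

Section step.
Context {n : nat} (mu : {sigma_finite_measure set 'rV[R]_n -> \bar R}).

Definition lebesgue_rV_step : set 'rV[R]_n.+1 -> \bar R :=
  pushforward (@lebesgue_measure R \x mu) (@rV_cons n).

Let step0 : lebesgue_rV_step set0 = 0.
Proof. exact: measure0. Qed.

Let step_ge0 A : 0 <= lebesgue_rV_step A.
Proof. exact: measure_ge0. Qed.

Let step_sigma_additive : semi_sigma_additive lebesgue_rV_step.
Proof. exact: measure_semi_sigma_additive. Qed.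

HB.instance Definition _ := isMeasure.Build _ _ _ lebesgue_rV_step
  step0 step_ge0 step_sigma_additive.

Definition rV_box (A : set R) (B : set 'rV[R]_n) : set 'rV[R]_n.+1 :=
  [set x | A (x ord0 ord0) /\ B (\row_j x ord0 (lift ord0 j))].

Lemma rV_cons_box A B : @rV_cons n @^-1` rV_box A B = A `*` B.
Proof.
apply/seteqP; split=> -[a b] /=; rewrite /rV_box /= rV_cons0;
  rewrite (_ : \row_j _ = b)//; by apply/rowP => j; rewrite mxE rV_consS.
Qed.

Lemma measurable_rV_box A B :
  measurable A -> measurable B -> measurable (rV_box A B).
Proof.
move=> mA mB; apply: measurableI.
  by rewrite -[X in measurable X]setTI; exact: measurable_coord.
rewrite -[X in measurable X]setTI.
have : measurable_fun setT
    (fun x : 'rV[R]_n.+1 => \row_j x ord0 (lift ord0 j) : 'rV[R]_n).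
  apply: measurable_fun_coordP => j; under eq_fun do rewrite mxE.
  exact: measurable_coord.
exact.
Qed.

Lemma lebesgue_rV_step_box A B : measurable A -> measurable B ->
  lebesgue_rV_step (rV_box A B) = lebesgue_measure A * mu B.
Proof.
by move=> mA mB; rewrite /lebesgue_rV_step /pushforward rV_cons_box
  product_measure1E.
Qed.

Let step_sigma_finite : sigma_finite setT lebesgue_rV_step.
Proof.
have /sigma_finiteP[F [TF ndF Foo]] := sigma_finiteT (@lebesgue_measure R).
have /sigma_finiteP[G [TG ndG Goo]] := sigma_finiteT mu.
exists (fun k => rV_box (F k) (G k)).
  apply/esym/seteqP; split=> // x _.
  have : [set: measurableTypeR R] (x ord0 ord0) by [].
  rewrite TF => -[a _ Fa].
  have : [set: 'rV[R]_n] (\row_j x ord0 (lift ord0 j)) by [].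
  rewrite TG => -[b _ Gb].
  exists (maxn a b) => //; split.
    by move: Fa; exact/subsetPset/ndF/leq_maxl.
  by move: Gb; exact/subsetPset/ndG/leq_maxr.
move=> k; have [? ?] := Foo k; have [? ?] := Goo k.
split; first exact: measurable_rV_box.
by rewrite lebesgue_rV_step_box// lte_mul_pinfty// ge0_fin_numE.
Qed.

HB.instance Definition _ := @Measure_isSigmaFinite.Build _ _ _ lebesgue_rV_step
  step_sigma_finite.

End step.

(* Lebesgue measure on R^n, as the n-fold product of Lebesgue measure on R *)
Fixpoint lebesgue_rV (n : nat) : {sigma_finite_measure set 'rV[R]_n -> \bar R} :=
  if n is m.+1 then lebesgue_rV_step (lebesgue_rV m) else \d_(0%R : 'rV[R]_0).

Lemma lebesgue_rV_prod n (A : 'I_n -> set R) :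
  (forall i, measurable (A i)) ->
  lebesgue_rV n [set x | forall i, A i (x ord0 i)] =
  \prod_(i < n) lebesgue_measure (A i).
Proof.
elim: n A => [|n IH] A mA.
  by rewrite big_ord0 /= diracE mem_set// => -[].
have mB : measurable [set x : 'rV[R]_n | forall i, A (lift ord0 i) (x ord0 i)].
  rewrite (_ : [set _ | _] = \bigcap_(i in [set: 'I_n])
    ((fun x : 'rV[R]_n => x ord0 i) @^-1` A (lift ord0 i))); last first.
    by apply/seteqP; split=> [x Ax i _|x Ax i]; exact: Ax.
  apply: fin_bigcap_measurable => // i _.
  by rewrite -[X in measurable X]setTI; exact: measurable_coord.
rewrite big_ord_recl -(IH (fun i => A (lift ord0 i)))// -lebesgue_rV_step_box//=.
congr (lebesgue_rV_step _ _); apply/seteqP; split=> x /=.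
  by move=> Ax; split=> // i; rewrite mxE.
move=> [A0 AS] i; case: (unliftP ord0 i) => [j|] ->//.
by have := AS j; rewrite mxE.
Qed.

End lebesgue_rV.

Section functions.
Context {R : realType} {n : nat}.
Local Open Scope complex_scope.

Definition C1_real (g : 'rV[R]_n -> R) :=
  (forall x, differentiable g x) /\
  (forall i : 'I_n, continuous (fun x => 'D_(delta_mx ord0 i) g x)).

Definition re_part (f : 'rV[R]_n -> R[i]) : 'rV[R]_n -> R :=
  fun x => complex.Re (f x).
Definition im_part (f : 'rV[R]_n -> R[i]) : 'rV[R]_n -> R :=
  fun x => complex.Im (f x).

(* C_0^1(R^n) for complex-valued functions, real-valued ones being those with
   zero imaginary part; R[i] is not a normed module over R in the library, so
   differentiability is expressed on the real and imaginary parts. *)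
Definition C1c (f : 'rV[R]_n -> R[i]) :=
  [/\ C1_real (re_part f), C1_real (im_part f) &
      compact (closure [set x | f x != 0])].

Definition gradient (f : 'rV[R]_n -> R[i]) (x : 'rV[R]_n) : 'rV[R[i]]_n :=
  \row_i ('D_(delta_mx ord0 i) (re_part f) x +i*
          'D_(delta_mx ord0 i) (im_part f) x).

(* The library's norm on 'rV is the sup norm. *)
Definition euclidean_norm (x : 'rV[R]_n) : R :=
  Num.sqrt (\sum_i x ord0 i ^+ 2).

Definition hermitian_norm (z : 'rV[R[i]]_n) : R :=
  Num.sqrt (\sum_i Normc.normc (z ord0 i) ^+ 2).

End functions.

(* Main.v *)
Require Import Defs.
From mathcomp Require Import all_boot all_order all_algebra.
From mathcomp Require Import all_classical all_reals all_analysis.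
From mathcomp Require Import measurable_realfun complex ring lra.
Import Order.TTheory GRing.Theory Num.Theory numFieldNormedType.Exports.
Local Open Scope classical_set_scope.
Local Open Scope ring_scope.

(* Write f = u + i v and let A, B, C be the integrals of |f|^2, |grad f|^2 and
   |x|^2 |f|^2.  The partial derivative D_i (x_i |f|^2) has integral 0, by Fubini
   and the fundamental theorem of calculus along the i-th axis; summing over i,
   the integral of the sum of the 2 x_i (u D_i u + v D_i v) equals - n A.  Hence for
   every real s,
     0 <= int sum_i ((s D_i u + x_i u)^2 + (s D_i v + x_i v)^2)
        = s^2 B - s n A + C,
   and the discriminant n^2 A^2 - 4 B C of this quadratic in s is nonpositive. *)

Lemma ball_rVP (R : realType) n (x y : 'rV[R]_n) (e : R) : 0 < e ->
  ball x e y <-> forall i, `|x ord0 i - y ord0 i| < e.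
Proof.
move=> e0; split=> [[_ xy] i|xy]; first exact: (xy ord0 i).
by split=> // i j; rewrite (ord1 i); exact: xy.
Qed.

Lemma open_measurable_rV (R : realType) n (U : set 'rV[R]_n) :
  open U -> measurable U.
Proof.
move=> oU.
pose box (p : 'rV[rat]_n * nat) : set 'rV[R]_n :=
  [set y | forall i, `|ratr (p.1 ord0 i) - y ord0 i| < p.2.+1%:R^-1].
pose F p := if `[< box p `<=` U >] then box p else set0.
have mF p : measurable (F p).
  rewrite /F; case: ifP => // _.
  rewrite (_ : box p = \bigcap_(i in [set: 'I_n])
      ((fun x : 'rV[R]_n => x ord0 i) @^-1` (ball (ratr (p.1 ord0 i) : R) p.2.+1%:R^-1))).
    apply: fin_bigcap_measurable => // i _.
    rewrite -[X in measurable X]setTI; apply: measurable_coord => //.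
    by apply: open_measurable; exact: ball_open.
  by apply/seteqP; split=> [y + i _|y + i]; [exact|exact].
suff -> : U = \bigcup_p F p by exact: countable_bigcupT_measurable.
apply/seteqP; split=> [x Ux|x [p _]]; last first.
  by rewrite /F; case: ifPn => // /asboolP; exact.
have : nbhs x U by move: oU; rewrite openE; exact.
move=> /nbhs_ballP[e /= e0 xeU].
have e20 : 0 < e / 2 by rewrite divr_gt0.
pose k := Num.truncn (e / 2)^-1.
have ke : k.+1%:R^-1 < e / 2 by rewrite invf_plt ?posrE// truncnS_gt.
have k0 : 0 < k.+1%:R^-1 :> R by rewrite invr_gt0.
have qP i : {q : rat | `|ratr q - x ord0 i| < k.+1%:R^-1}.
  apply: cid.
  have : x ord0 i - k.+1%:R^-1 < x ord0 i + k.+1%:R^-1.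
    by rewrite ltrD2l gtrN.
  move=> /rat_in_itvoo[q]; rewrite in_itv/= => /andP[xq qx]; exists q.
  by rewrite ltr_distl xq qx.
pose q : 'rV[rat]_n := \row_i sval (qP i).
have qx i : `|ratr (q ord0 i) - x ord0 i| < k.+1%:R^-1.
  by rewrite mxE; exact: svalP (qP i).
exists (q, k) => //; rewrite /F ifT//; apply/asboolP => y /= yq.
apply: xeU; apply/ball_rVP => // i.
rewrite (le_lt_trans (ler_distD (ratr (q ord0 i)) _ _))//.
by rewrite [e]splitr ltrD// ?(distrC (x _ _)) (lt_trans _ ke).
Qed.

Lemma continuous_measurable_rV (R : realType) n (f : 'rV[R]_n -> R) :
  continuous f -> measurable_fun [set: 'rV[R]_n] f.
Proof.
move=> cf; apply: (measurability _ (RGenOInfty.measurableE R)) => //.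
move=> _ [_ [a ->] <-]; rewrite setTI; apply: open_measurable_rV.
by apply: open_comp => // ? _; exact: cf.
Qed.

Lemma bounded_support_integrable d (T : measurableType d) (R : realType)
    (mu : {measure set T -> \bar R}) (A : set T) (f : T -> R) (M : R) :
  measurable A -> (mu A < +oo)%E -> measurable_fun [set: T] f ->
  (forall x, `|f x| <= M) -> (forall x, ~ A x -> f x = 0) ->
  mu.-integrable [set: T] (EFin \o f).
Proof.
move=> mA muA mf fM f0.
have -> : EFin \o f = (EFin \o f) \_ A.
  by apply/funext => x; rewrite patchE; case: ifPn => // /negP;
    rewrite inE => /f0 /= ->.
apply/(integrable_mkcond _ mA); apply: measurable_bounded_integrable => //.
  exact: measurable_funTS.
exists M; split; first exact: num_real.
by move=> y My x _ /=; rewrite (le_trans (fM x))// ltW.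
Qed.

Section cube.
Context {R : realType} {n : nat}.

Definition cube (M : R) : set 'rV[R]_n := [set x | forall i, `|x ord0 i| <= M].

Lemma cubeE M : cube M = [set x | forall i, `[- M, M]%classic (x ord0 i)].
Proof.
by apply/seteqP; split=> x xM i; move: (xM i); rewrite /= in_itv/= ler_norml.
Qed.

Lemma measurable_cube M : measurable (cube M).
Proof.
rewrite cubeE [X in measurable X](_ : _ = \bigcap_(i in [set: 'I_n])
    ((fun x : 'rV[R]_n => x ord0 i) @^-1` `[- M, M]%classic)).
  apply: fin_bigcap_measurable => // i _.
  by rewrite -[X in measurable X]setTI; exact: measurable_coord.
by apply/seteqP; split=> [y + i _|y + i]; [exact|exact].
Qed.

Lemma lebesgue_rV_cube_lty M : (lebesgue_rV n (cube M) < +oo)%E.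
Proof.
rewrite cubeE (@lebesgue_rV_prod R n (fun=> `[- M, M]%classic))//.
suff : (\prod_(i < n) lebesgue_measure (`[(- M)%R, M]%classic : set R))%E \is a fin_num.
  by move=> /fin_numPlt /andP[].
elim/big_ind : _ => // [x y xf yf|i _]; first by rewrite fin_numM.
by rewrite lebesgue_measure_itv/=; case: ifP.
Qed.

End cube.

Lemma is_derive_comp_affine (R : numFieldType) (U V W : normedModType R)
    (h : V -> W) (phi : U -> V) (x u : U) (v : V) (d : W) :
  (forall t : R, phi (t *: u + x) = t *: v + phi x) ->
  is_derive (phi x) v h d -> is_derive x u (h \o phi) d.
Proof.
move=> phiE [hd <-].
have E : (fun t : R => t^-1 *: (((h \o phi) \o shift x) (t *: u) - (h \o phi) x)) =
         (fun t : R => t^-1 *: ((h \o shift (phi x)) (t *: v) - h (phi x))).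
  by apply/funext => t /=; rewrite phiE.
by split; rewrite /derivable /derive E.
Qed.

Section cons.
Context {R : realType} {n : nat}.

Lemma rV_consP (x : 'rV[R]_n.+1) (p : measurableTypeR R * 'rV[R]_n) :
  x ord0 ord0 = p.1 -> (forall j, x ord0 (lift ord0 j) = p.2 ord0 j) ->
  x = rV_cons p.
Proof.
move=> x0 xS; apply/rowP => i; case: (unliftP ord0 i) => [j|] ->.
  by rewrite xS rV_consS.
by rewrite x0 rV_cons0.
Qed.

Lemma continuous_rV_consl (b : 'rV[R]_n) :
  continuous (fun a : R => rV_cons (a, b)).
Proof.
move=> a U /nbhs_ballP[e /= e0 eU].
apply/nbhs_ballP; exists e => //= a' aa'.
apply/eU/ball_rVP => // i; case: (unliftP ord0 i) => [j|] ->.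
  by rewrite !rV_consS subrr normr0.
by rewrite !rV_cons0.
Qed.

Lemma continuous_rV_consr (a : R) :
  continuous (fun b : 'rV[R]_n => rV_cons (a, b)).
Proof.
move=> b U /nbhs_ballP[e /= e0 eU].
apply/nbhs_ballP; exists e => //= b' /ball_rVP bb'.
apply/eU/ball_rVP => // i; case: (unliftP ord0 i) => [j|] ->.
  by rewrite !rV_consS bb'.
by rewrite !rV_cons0 subrr normr0.
Qed.

Lemma rV_cons_shiftl (a t : R) (b : 'rV[R]_n) :
  rV_cons (t * 1 + a, b) = t *: delta_mx ord0 ord0 + rV_cons (a, b).
Proof.
apply/esym/rV_consP => [|j]; rewrite mxE.
  by rewrite rV_cons0 !mxE !eqxx.
by rewrite rV_consS !mxE /= mulr0 add0r.
Qed.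

Lemma rV_cons_shiftr (a t : R) (b : 'rV[R]_n) (j : 'I_n) :
  rV_cons (a, t *: delta_mx ord0 j + b) =
  t *: delta_mx ord0 (lift ord0 j) + rV_cons (a, b).
Proof.
apply/esym/rV_consP => [|k]; rewrite mxE.
  by rewrite rV_cons0 !mxE /= mulr0 add0r.
by rewrite rV_consS !mxE (inj_eq lift_inj).
Qed.

End cons.

Lemma integral_bounded_support_derive (R : realType) (h g : R -> R) (M : R) :
  continuous g -> (forall a : R, is_derive a (1 : R) h (g a)) ->
  (forall a, M < `|a| -> h a = 0 /\ g a = 0) ->
  (\int[lebesgue_measure]_a (g a)%:E = 0)%E.
Proof.
move=> cg hg supp; pose N := `|M| + 1.
have MN : M < N by rewrite (le_lt_trans (ler_norm M))// ltrDl.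
have N0 : 0 < N by rewrite ltr_pwDr.
have ch : continuous h.
  move=> a; have [hda _] := hg a.
  by apply: differentiable_continuous; apply/derivable1_diffP.
transitivity (\int[lebesgue_measure]_(a in `[(- N)%R, N]) (g a)%:E)%E.
  rewrite [RHS]integral_mkcond; apply: eq_integral => a _.
  rewrite patchE; case: ifPn => // /negP; rewrite inE /= in_itv/= => aN.
  suff [_ ->] : h a = 0 /\ g a = 0 by [].
  apply: supp; rewrite (lt_trans MN)// ltNge; apply/negP.
  by rewrite ler_norml.
rewrite (@continuous_FTC2 _ g h) ?gtrN//.
- have [-> _] : h N = 0 /\ g N = 0 by apply: supp; rewrite gtr0_norm.
  have [-> _] : h (- N) = 0 /\ g (- N) = 0 by apply: supp; rewrite normrN gtr0_norm.
  by rewrite subee.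
- exact: continuous_subspaceT.
- split=> [a _||]; first by have [] := hg a.
    by apply: cvg_at_right_filter; exact: ch.
  by apply: cvg_at_left_filter; exact: ch.
- by move=> a _; rewrite derive1E; have [_ ->] := hg a.
Qed.

Lemma lebesgue_rV_integrable (R : realType) n (g : 'rV[R]_n -> R) (M : R) :
  continuous g -> (forall x, `|g x| <= M) ->
  (forall x, ~ cube M x -> g x = 0) ->
  (lebesgue_rV n).-integrable [set: 'rV[R]_n] (EFin \o g).
Proof.
move=> cg gM g0.
apply: (@bounded_support_integrable _ _ _ _ (cube M) g M) => //.
- exact: measurable_cube.
- exact: lebesgue_rV_cube_lty.
- exact: continuous_measurable_rV.
Qed.

Lemma integral_partial_derivative_eq0 (R : realType) n (i : 'I_n)
    (h g : 'rV[R]_n -> R) (M : R) :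
  continuous g -> (forall x, is_derive x (delta_mx ord0 i) h (g x)) ->
  (forall x, `|g x| <= M) -> (forall x, ~ cube M x -> h x = 0 /\ g x = 0) ->
  (\int[lebesgue_rV n]_x (g x)%:E = 0)%E.
Proof.
elim: n i h g => [[]//|n IH] i h g cg hg gM supp.
have mg : measurable_fun [set: 'rV[R]_n.+1] (EFin \o g).
  by apply/measurable_EFinP; exact: continuous_measurable_rV.
have ig : (lebesgue_measure \x lebesgue_rV n)%E.-integrable setT
    ((EFin \o g) \o @rV_cons R n).
  apply: (@bounded_support_integrable _ _ _ _ (@rV_cons R n @^-1` cube M)
    (g \o @rV_cons R n) M).
  - rewrite -[X in measurable X]setTI.
    by apply: measurable_rV_cons => //; exact: measurable_cube.
  - exact: (@lebesgue_rV_cube_lty R n.+1 M).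
  - apply: measurableT_comp; last exact: measurable_rV_cons.
    exact: continuous_measurable_rV.
  - by move=> x; exact: gM.
  - by move=> x /supp[].
rewrite /= /lebesgue_rV_step.
rewrite (@integral_pushforward _ _ _ _ R (@rV_cons R n) (@measurable_rV_cons R n))//.
rewrite preimage_setT.
have csupp a (b : 'rV[R]_n) : M < `|a| \/ ~ cube M b -> ~ cube M (rV_cons (a, b)).
  move=> [aM /(_ ord0)|bM abM]; first by rewrite rV_cons0 leNgt aM.
  by apply: bM => j; have := abM (lift ord0 j); rewrite rV_consS.
case: (unliftP ord0 i) hg => [j|] -> hg.
  rewrite -integral12_prod_meas1//; apply: integral0_eq => a _.
  apply: (IH j (fun b => h (rV_cons (a, b))) (fun b => g (rV_cons (a, b)))).
  - move=> b; apply: continuous_comp; [exact: continuous_rV_consr|exact: cg].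
  - move=> b; apply: (@is_derive_comp_affine _ _ _ _ h
        (fun b : 'rV[R]_n => rV_cons (a, b)) _ _ (delta_mx ord0 (lift ord0 j))) => // t.
    exact: rV_cons_shiftr.
  - by move=> b; exact: gM.
  - by move=> b bM; apply/supp/csupp; right.
rewrite -integral21_prod_meas1//; apply: integral0_eq => b _.
apply: (@integral_bounded_support_derive R (fun a => h (rV_cons (a, b)))
  (fun a => g (rV_cons (a, b))) M).
- move=> a; apply: continuous_comp; [exact: continuous_rV_consl|exact: cg].
- move=> a; apply: (@is_derive_comp_affine _ _ _ _ h
        (fun a : R => rV_cons (a, b)) _ _ (delta_mx ord0 ord0)) => // t.
  exact: rV_cons_shiftl.
- by move=> a aM; apply/supp/csupp; left.
Qed.

Lemma compact_support_bounds (R : realType) n (K : set 'rV[R]_n)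
    (g : 'rV[R]_n -> R) :
  compact K -> continuous g -> (forall x, ~ K x -> g x = 0) ->
  exists M, [/\ forall x, `|g x| <= M & K `<=` cube M].
Proof.
move=> cK cg g0.
have [N [_ /(_ (`|N| + 1))KN]] := compact_bounded cK.
have cgK : compact (g @` K).
  by apply: continuous_compact => //; exact: continuous_subspaceT.
have [N' [_ /(_ (`|N'| + 1))gN']] := compact_bounded cgK.
have {}KN x : K x -> `|x| <= `|N| + 1.
  by apply: KN; rewrite (le_lt_trans (ler_norm N))// ltrDl.
have {}gN' x : K x -> `|g x| <= `|N'| + 1.
  move=> Kx; apply: gN'; last by exists x.
  by rewrite (le_lt_trans (ler_norm N'))// ltrDl.
exists ((`|N| + 1) + (`|N'| + 1)); split=> [x|x /KN xN i].
  have [/gN' gx|/g0 ->] := pselect (K x).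
    by rewrite (le_trans gx)// lerDr addr_ge0.
  by rewrite normr0 !addr_ge0.
have : `|x ord0 i| <= `|x|.
  rewrite [leRHS]mx_normrE.
  exact: (le_bigmax _ (fun ij => `|x ij.1 ij.2|) (ord0, i)).
by move=> /le_trans; apply; rewrite (le_trans xN)// lerDl addr_ge0.
Qed.

Definition continuous_supported {R : realType} {n : nat} (K : set 'rV[R]_n)
    (g : 'rV[R]_n -> R) : Prop :=
  continuous g /\ forall x, ~ K x -> g x = 0.

Section continuous_supported.
Context {R : realType} {n : nat} (K : set 'rV[R]_n).
Implicit Types g h : 'rV[R]_n -> R.

Lemma continuous_supportedD g h :
  continuous_supported K g -> continuous_supported K h ->
  continuous_supported K (fun x => g x + h x).
Proof.
move=> [cg g0] [ch h0]; split=> [x|x Kx]; last by rewrite g0// h0// addr0.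
by apply: (@continuousD _ _ _ g h); [exact: cg|exact: ch].
Qed.

Lemma continuous_supportedMl g h : continuous g ->
  continuous_supported K h -> continuous_supported K (fun x => g x * h x).
Proof.
move=> cg [ch h0]; split=> [x|x Kx]; last by rewrite h0// mulr0.
by apply: (@continuousM _ _ g h); [exact: cg|exact: ch].
Qed.

Lemma continuous_supportedZ (r : R) g :
  continuous_supported K g -> continuous_supported K (fun x => r * g x).
Proof. by move=> sg; apply: (continuous_supportedMl (fun=> r)) => //; exact: cst_continuous. Qed.

Lemma continuous_supported_sum m (F : 'I_m -> 'rV[R]_n -> R) :
  (forall i, continuous_supported K (F i)) ->
  continuous_supported K (fun x => \sum_i F i x).
Proof.
move=> cF; rewrite (_ : (fun _ => _) = \sum_i F i); last first.
  by apply/funext => x; rewrite fct_sumE.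
elim/big_ind : _ => // [|g h]; last exact: continuous_supportedD.
by split=> [|//]; exact: cst_continuous.
Qed.

Lemma continuous_supported_integrable g : compact K ->
  continuous_supported K g ->
  (lebesgue_rV n).-integrable [set: 'rV[R]_n] (EFin \o g).
Proof.
move=> cK [cg g0]; have [M [gM KM]] := compact_support_bounds _ _ _ _ cK cg g0.
by apply: (lebesgue_rV_integrable _ _ _ M) => // x xM; apply: g0 => /KM.
Qed.

Lemma C1_real_continuous g : C1_real g -> continuous g.
Proof. by move=> [dg _] x; exact: differentiable_continuous. Qed.

Lemma partial_derivative_supported g (i : 'I_n) : closed K -> C1_real g ->
  (forall x, ~ K x -> g x = 0) ->
  continuous_supported K ('D_(delta_mx ord0 i) g).
Proof.
move=> cK [_ cg] g0; split=> [|x Kx]; first exact: cg.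
rewrite (@near_eq_derive _ _ _ g (cst 0)) ?derive_cst//.
have : nbhs x (~` K) by apply: open_nbhs_nbhs; split=> //; exact: closed_openC.
by apply: filterS => y; exact: g0.
Qed.

Lemma is_derive_coord (i : 'I_n) (x : 'rV[R]_n) :
  is_derive x (delta_mx ord0 i) (fun y => y ord0 i) (1 : R).
Proof.
apply: (@is_derive_comp_affine _ _ _ _ (@id R) (fun y : 'rV[R]_n => y ord0 i)
  x (delta_mx ord0 i) (1 : R) 1) => t.
by rewrite !mxE !eqxx.
Qed.

End continuous_supported.

Lemma discriminant_bound (R : realFieldType) (a b c : R) (n : nat) : (0 < n)%N ->
  0 <= a -> 0 <= b -> 0 <= c ->
  (forall s, 0 <= s ^+ 2 * b - s * n%:R * a + c) ->
  a ^+ 2 <= (2 / n%:R) ^+ 2 * b * c.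
Proof.
move=> n0 a0 b0 c0 q; have {}n0 : 0 < n%:R :> R by rewrite ltr0n.
have [b00|bn0] := eqVneq b 0.
  have [->|an0] := eqVneq a 0; first by rewrite expr0n/= !mulr_ge0 ?exprn_ge0 ?divr_ge0.
  have := q ((c + 1) / (n%:R * a)).
  rewrite b00 mulr0 sub0r -mulrA divfK ?mulf_neq0 ?gt_eqF//; lra.
have {}b0 : 0 < b by rewrite lt_neqAle eq_sym bn0.
have := q (n%:R * a / (2 * b)).
have -> : (n%:R * a / (2 * b)) ^+ 2 * b - n%:R * a / (2 * b) * n%:R * a + c =
   (4 * b * c - n%:R ^+ 2 * a ^+ 2) / (4 * b) by field.
rewrite pmulr_lge0 ?invr_gt0 ?mulr_gt0// subr_ge0 => H.
have -> : (2 / n%:R) ^+ 2 * b * c = (4 * b * c) / n%:R ^+ 2.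
  by field; rewrite gt_eqF.
by rewrite ler_pdivlMr ?exprn_gt0// mulrC.
Qed.

Section uncertainty.
Context {R : realType} {n : nat} (K : set 'rV[R]_n) (u v : 'rV[R]_n -> R).
Hypotheses (cK : compact K) (Cu : C1_real u) (Cv : C1_real v)
  (u0 : forall x, ~ K x -> u x = 0) (v0 : forall x, ~ K x -> v x = 0).

Let D (g : 'rV[R]_n -> R) (i : 'I_n) : 'rV[R]_n -> R := 'D_(delta_mx ord0 i) g.
Let a (x : 'rV[R]_n) : R := u x ^+ 2 + v x ^+ 2.
Let b (x : 'rV[R]_n) : R := \sum_i (D u i x ^+ 2 + D v i x ^+ 2).
Let c (x : 'rV[R]_n) : R := (\sum_i x ord0 i ^+ 2) * a x.
Let d i (x : 'rV[R]_n) : R := a x + x ord0 i * (2 * (u x * D u i x + v x * D v i x)).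

Let clK : closed K.
Proof. by apply: compact_closed => //; exact: norm_hausdorff. Qed.

Let su : continuous_supported K u.
Proof. by split=> //; exact: C1_real_continuous. Qed.
Let sv : continuous_supported K v.
Proof. by split=> //; exact: C1_real_continuous. Qed.
Let sDu i : continuous_supported K (D u i).
Proof. exact: partial_derivative_supported. Qed.
Let sDv i : continuous_supported K (D v i).
Proof. exact: partial_derivative_supported. Qed.

Let ccoord i : continuous (fun x : 'rV[R]_n => x ord0 i).
Proof. exact: coord_continuous. Qed.

Lemma norm2_supported : continuous_supported K a.
Proof.
by apply: continuous_supportedD; apply: continuous_supportedMl => //;
  [have [] := su|have [] := sv].
Qed.

Lemma gradient_norm2_supported : continuous_supported K b.
Proof.
apply: continuous_supported_sum => i.
by apply: continuous_supportedD; apply: continuous_supportedMl => //;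
  [have [] := sDu i|have [] := sDv i].
Qed.

Lemma weighted_norm2_supported : continuous_supported K c.
Proof.
rewrite /c; under eq_fun do rewrite mulr_suml.
apply: continuous_supported_sum => i.
under eq_fun do rewrite expr2 -mulrA.
do 2 (apply: continuous_supportedMl => //); exact: norm2_supported.
Qed.

Let sd i : continuous_supported K (d i).
Proof.
apply: continuous_supportedD; first exact: norm2_supported.
apply: continuous_supportedMl => //; apply: continuous_supportedZ.
by apply: continuous_supportedD; apply: continuous_supportedMl => //;
  [have [] := su|have [] := sv].
Qed.

Let integral_d i : (\int[lebesgue_rV n]_x (d i x)%:E = 0)%E.
Proof.
have [cd d0] := sd i.
have [M [dM KM]] := compact_support_bounds _ _ _ _ cK cd d0.
apply: (@integral_partial_derivative_eq0 R n i
  ((fun x : 'rV[R]_n => x ord0 i) * (u * u + v * v)) (d i) M) => //; last first.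
  move=> x xM; have {xM}Kx : ~ K x by move=> /KM.
  by split; [rewrite /= !fctE u0// v0// !mulr0 addr0 mulr0|exact: d0].
move=> x; have hx := is_derive_coord i x.
have hu : is_derive x (delta_mx ord0 i) u (D u i x).
  by split=> //; apply: diff_derivable; have [] := Cu.
have hv : is_derive x (delta_mx ord0 i) v (D v i x).
  by split=> //; apply: diff_derivable; have [] := Cv.
apply: is_derive_eq; rewrite /d /a !fctE /GRing.scale /=; ring.
Qed.

Lemma uncertainty_quadratic (s : R) :
  0 <= s ^+ 2 * (\int[lebesgue_rV n]_x b x)%R
     - s * n%:R * (\int[lebesgue_rV n]_x a x)%R
     + (\int[lebesgue_rV n]_x c x)%R.
Proof.
have sG : continuous_supported K (fun x => \sum_i d i x).
  by apply: continuous_supported_sum => i; exact: sd.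
have G0 : (\int[lebesgue_rV n]_x (\sum_i d i x))%R = 0.
  rewrite /Rintegral; under eq_integral do rewrite -sumEFin.
  rewrite integral_sum//; first by rewrite big1// => i _; exact: integral_d.
  by move=> i; exact: (continuous_supported_integrable _ _ cK (sd i)).
have sa := norm2_supported; have sb := gradient_norm2_supported.
have sc := weighted_norm2_supported.
have ints g : continuous_supported K g ->
    (lebesgue_rV n).-integrable [set: 'rV[R]_n] (EFin \o g).
  exact: continuous_supported_integrable.
rewrite (_ : - (_ * _) = - (s * n%:R) * (\int[lebesgue_rV n]_x a x)%R +
    s * (\int[lebesgue_rV n]_x (\sum_i d i x))%R); last first.
  by rewrite G0 mulr0 addr0 mulNr.
rewrite -!RintegralZl//; try exact: ints.
have sZ r g : continuous_supported K g ->
  continuous_supported K (fun x => r * g x) by exact: continuous_supportedZ.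
have sD g h : continuous_supported K g -> continuous_supported K h ->
  continuous_supported K (fun x => g x + h x) by exact: continuous_supportedD.
rewrite -!RintegralD//; try by apply: ints; auto.
apply: Rintegral_ge0 => x _.
suff -> : s ^+ 2 * b x + (- (s * n%:R) * a x + s * \sum_i d i x) + c x =
    \sum_i ((s * D u i x + x ord0 i * u x) ^+ 2 +
            (s * D v i x + x ord0 i * v x) ^+ 2).
  by apply: sumr_ge0 => i _; rewrite addr_ge0 ?sqr_ge0.
have -> : - (s * n%:R) * a x = \sum_(i < n) (- s * a x).
  by rewrite sumr_const card_ord -mulr_natr; ring.
rewrite /b /c mulr_suml !mulr_sumr -!big_split/=.
by apply: eq_bigr => i _; rewrite /d /a; ring.
Qed.

Lemma uncertainty : (0 < n)%N ->
  ((\int[lebesgue_rV n]_x (a x)%:E) ^+ 2 <=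
   ((2 / n%:R) ^+ 2)%:E * (\int[lebesgue_rV n]_x (b x)%:E)
     * (\int[lebesgue_rV n]_x (c x)%:E))%E.
Proof.
move=> n0.
have fin g : continuous_supported K g ->
    (\int[lebesgue_rV n]_x (g x)%:E = (\int[lebesgue_rV n]_x g x)%R%:E)%E.
  move=> sg; rewrite /Rintegral fineK//; apply: integrable_fin_num => //.
  exact: (continuous_supported_integrable _ _ cK sg).
rewrite (fin _ norm2_supported) (fin _ gradient_norm2_supported).
rewrite (fin _ weighted_norm2_supported) -EFin_expe -!EFinM lee_fin.
have a0 x : 0 <= a x by rewrite addr_ge0 ?sqr_ge0.
apply: discriminant_bound => //; last exact: uncertainty_quadratic.
- by apply: Rintegral_ge0 => x _; exact: a0.
- by apply: Rintegral_ge0 => x _; apply: sumr_ge0 => i _; rewrite addr_ge0 ?sqr_ge0.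
- apply: Rintegral_ge0 => x _; rewrite mulr_ge0//.
  by apply: sumr_ge0 => i _; rewrite sqr_ge0.
Qed.

End uncertainty.

Lemma normc_sqr (R : realType) (z : R[i]%C) :
  Normc.normc z ^+ 2 = complex.Re z ^+ 2 + complex.Im z ^+ 2.
Proof. by case: z => x y /=; rewrite sqr_sqrtr// addr_ge0 ?sqr_ge0. Qed.

Local Open Scope ereal_scope.

Theorem mainTheorem7 (R : realType) (n : nat) (hn : (2 <= n)%N)
    (f : 'rV[R]_n -> R[i]%C) (hf : C1c f) :
  (\int[lebesgue_rV n]_x ((Normc.normc (f x)) ^+ 2)%:E) ^+ 2 <=
  ((2 / n%:R) ^+ 2)%:E
  * (\int[lebesgue_rV n]_x ((hermitian_norm (gradient f x)) ^+ 2)%:E)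
  * (\int[lebesgue_rV n]_x ((euclidean_norm x) ^+ 2 * (Normc.normc (f x)) ^+ 2)%:E).
Proof.
have [Cu Cv cK] := hf.
have f0 x : ~ closure [set x | f x != 0%R] x -> f x = 0%R.
  by move=> Kx; apply/eqP/negPn/negP => fx; apply: Kx; exact: subset_closure.
have u0 x : ~ closure [set x | f x != 0%R] x -> re_part f x = 0%R.
  by move=> /f0; rewrite /re_part => ->.
have v0 x : ~ closure [set x | f x != 0%R] x -> im_part f x = 0%R.
  by move=> /f0; rewrite /im_part => ->.
have := uncertainty _ _ _ cK Cu Cv u0 v0 (ltnW hn).
congr (_ ^+ 2 <= _ * _ * _); apply: eq_integral => x _; congr EFin.
- by rewrite normc_sqr.
- rewrite /hermitian_norm sqr_sqrtr; last by apply: sumr_ge0 => i _; rewrite sqr_ge0.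
  by apply: eq_bigr => i _; rewrite mxE normc_sqr.
- rewrite normc_sqr /euclidean_norm sqr_sqrtr//.
  by apply: sumr_ge0 => i _; rewrite sqr_ge0.
Qed.
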